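(* Let $C_9$ be the cycle graph on $9$ vertices, with adjacency matrix $A = A(C_9)$, and let $U(t) = e^{itA}$ for $t \in \mathbb{R}$. Then $C_9$ does not exhibit uniform mixing at any time $t \in \mathbb{R}$; that is, there is no $t \in \mathbb{R}$ such that every entry of the matrix $U(t)$ has squared magnitude $1/9$.
   Context: For a graph $G$ on $n$ vertices with adjacency matrix $A(G)$, the transition matrix of the continuous-time quantum walk on $G$ is $U(t) := e^{itA(G)}$ (matrix exponential), $t \in \mathbb{R}$. The graph $G$ exhibits (admits) uniform mixing at time $t$ if every entry of $U(t)$ has squared magnitude $1/n$, i.e. $|U(t)_{a,b}|^2 = 1/n$ for all vertices $a,b$. The cycle $C_9$ is the simple undirected graph with vertex set $\mathbb{Z}/9\mathbb{Z}$ in which $a$ and $b$ are adjacent if and only if $a - b = \pm 1$ in $\mathbb{Z}/9\mathbb{Z}$. *)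

(* Defs.v *)
From HB Require Import structures.
From mathcomp Require Import all_boot all_order all_algebra.
From mathcomp Require Import complex.
From mathcomp Require Import all_classical all_reals all_analysis.

Set Implicit Arguments.
Unset Strict Implicit.
Unset Printing Implicit Defensive.

Import Order.TTheory GRing.Theory Num.Theory.
Import numFieldNormedType.Exports.

Local Open Scope ring_scope.
Local Open Scope classical_set_scope.
Local Open Scope complex_scope.

Record sgraph (n : nat) := SGraph {
  edge :> rel 'I_n;
  edge_sym : symmetric edge;
  edge_irr : irreflexive edge
}.

Definition adjmx (K : pzRingType) (n : nat) (G : sgraph n) : 'M[K]_n :=
  \matrix_(a, b) (G a b)%:R.

(* The series is taken over an abstract numFieldType because R[i] carries no
   canonical topology of its own: instantiating K := R[i] gives the topology of
   the modulus, and matrices get the entrywise (product) topology. *)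
Definition expmx (K : numFieldType) (n : nat) (M : 'M[K]_n) : 'M[K]_n :=
  limn (series (fun k : nat => (k`!%:R)^-1 *: M ^+ k)).

Definition transition_mx (R : realType) (n : nat) (G : sgraph n) (t : R) :
    'M[R[i]]_n :=
  expmx (('i%C * t%:C) *: adjmx _ G).

(* On R[i] the norm `|z| is the modulus, as a complex number with null
   imaginary part; the equality below is therefore stated in R[i]. *)
Definition uniform_mixing (R : realType) (n : nat) (G : sgraph n) (t : R) :
    Prop :=
  forall a b : 'I_n, `|transition_mx G t a b| ^+ 2 = n%:R^-1.

(* 'Z_9 is convertible to 'I_9; the subtraction below is modulo 9. *)
Definition cycle9_edge : rel 'I_9 :=
  fun a b : 'Z_9 => (a - b == 1) || (a - b == -1).

Lemma cycle9_sym : symmetric cycle9_edge.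
Proof.
by move=> a b; rewrite /cycle9_edge -(opprB b a) eqr_opp eqr_oppLR orbC.
Qed.

Lemma cycle9_irr : irreflexive cycle9_edge.
Proof. by move=> a; rewrite /cycle9_edge subrr. Qed.

Definition C9 : sgraph 9 := SGraph cycle9_sym cycle9_irr.

(* Main.v *)
Require Import Defs.
From mathcomp Require Import all_boot all_order all_algebra.
From mathcomp Require Import complex ring lra zify.
From mathcomp Require Import all_classical all_reals all_analysis.

(** Let [x_k = exp(i t theta_k)], where [theta_k = 2 cos(2 pi k / 9)]; then
    [x_0 x_3^2 = 1] and [x_1 x_2 x_4 = 1]. Put [y_k = x_k / x_3], so that
    [y_3 = 1] and [y_0 = d := y_1 y_2 y_4]. Uniform mixing says that the
    Fourier transform of the symmetric sequence [y] on [Z/9] has constant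
    modulus 3. Multiplication by 2 permutes the indices 1, 2, 4 cyclically, so
    these equations simplify in terms of the Fourier transform [(s, T, V)] of
    [(y_1, y_2, y_4)] on [Z/3]; they force [d = 1] and [s = 0]. Hence
    [y_1^3 = d = 1], so both [3 t] and [3 t theta_1] lie in [2 pi Z]. As
    [theta_1] is a root of the irreducible polynomial [X^3 - 3 X + 1], this
    gives [t = 0], where [s = 3]. No transcendence argument is needed. *)

Set Implicit Arguments.
Unset Strict Implicit.
Unset Printing Implicit Defensive.
Import Order.TTheory GRing.Theory Num.Theory.
Import numFieldNormedType.Exports.
Local Open Scope ring_scope.
Local Open Scope classical_set_scope.

(** * Polynomial certificates and unimodular numbers *)

(** The algebra below consists of certificates: each use subtracts [c] times a hypothesis [a = b],
    and [ring] checks the identity left over. *)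
Lemma eq_lincomb (R : comPzRingType) (c a b x y : R) :
  a = b -> x - y = c * (a - b) -> x = y.
Proof. by move=> -> /eqP; rewrite subrr mulr0 subr_eq0 => /eqP. Qed.

Arguments eq_lincomb {R} c {a b x y}.

Lemma norm_unit_conj (C : numClosedFieldType) (z : C) : z * z^* = 1 -> `|z| = 1.
Proof. by move=> zz; apply/eqP; rewrite -sqrp_eq1 ?normr_ge0// normCK zz. Qed.

Lemma unit_conj_sum_neq (C : numClosedFieldType) (z : C) (n : nat) :
  z * z^* = 1 -> (2 < n)%N -> z + z^* != - n%:R.
Proof.
move=> zz n2; apply/eqP => h.
have z1 := norm_unit_conj zz; have := ler_normD z z^*.
rewrite h norm_conjC z1 normrN normr_nat -mulr2n ler_nat.
by rewrite leqNgt n2.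
Qed.

(** * Excluding [d != 1] for the transform on Z/3 *)

(* [(s, T, V)] stands for the Fourier transform on [Z/3] of unimodular numbers
   [y1, y2, y4] with product [d]: the last three hypotheses express that the
   [y_k] are unimodular, [shift_sum] and [shift_char] that the autocorrelations
   of the sequence [(d, y1, y2, 1, y4, y4, 1, y2, y1)] vanish. *)
Section FlatZ3Transform.
Variables (C : numClosedFieldType) (w d s e T V : C).
Hypothesis w_root : w ^+ 2 + w + 1 = 0.
Hypothesis wc : w^* = w ^+ 2.
Hypothesis dD : d * d^* = 1.
Let u := d - 1.
Hypothesis u0 : u != 0.
Hypothesis sue : s = u * e.
Hypothesis eE : e * e^* = 1.
Hypothesis shift_sum : u * s^* + u^* * s + s * s^* + 3 * (s + s^*) = 0.
Hypothesis shift_char : u * V^* + u^* * T + w * V * T^* = 0.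
Hypothesis parseval : s * s^* + T * T^* + V * V^* = 9.
Hypothesis orth0 : s * V^* + T * s^* + V * T^* = 0.
Hypothesis TV_eq : T * V = s ^+ 2 - 3 * d * s^*.

Let uE : u^* = - u * d^*.
Proof. by rewrite /u rmorphB rmorph1 /= mulNr mulrBl dD mul1r opprB. Qed.

Let sE : s^* = - u * d^* * e^*.
Proof. by rewrite [in LHS]sue rmorphM /= uE. Qed.

Let e0 : e != 0.
Proof.
by apply/eqP => h; have /eqP := eE; rewrite h mul0r eq_sym oner_eq0.
Qed.

Let d0 : d != 0.
Proof.
by apply/eqP => h; have /eqP := dD; rewrite h mul0r eq_sym oner_eq0.
Qed.

(** Subtracting [w] times [orth0] from [shift_char] cancels [V * T^*], and a factor [u] divides out
    of the rest. *)
Let HA : (1 - w * e) * V^* = d^* * (1 - w * e^*) * T.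
Proof.
apply: (mulfI u0).
have H : u * V^* + u^* * T + w * V * T^*
    - w * (s * V^* + T * s^* + V * T^*) = 0.
  by rewrite shift_char orth0 mulr0 subr0.
apply: (eq_lincomb 1 H); rewrite sE uE sue; ring.
Qed.

Let e_or : (e - 1) * (d * (2 * e + 1) + e + 2) = 0.
Proof.
apply: (mulfI u0); apply: (eq_lincomb (d * e) shift_sum).
rewrite sE uE sue /u; ring: dD eE.
Qed.

Let WE : T * V = u * e^* * (u * e ^+ 3 + 3).
Proof. rewrite TV_eq sE sue /u; ring: dD eE. Qed.

(* Otherwise [|u| = 3], whereas [d] has modulus 1. *)
Let W0 : T * V != 0.
Proof.
rewrite WE; apply: mulf_neq0; first by rewrite mulf_neq0 ?conjC_eq0.
apply/eqP => h.
have h' : u^* * e^* ^+ 3 + 3 = 0.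
  have := congr1 Num.conj h.
  by rewrite !(rmorphD, rmorphM, rmorphXn, rmorph_nat, rmorph0).
have : d + d^* != - 7%:R by exact: unit_conj_sum_neq.
case/eqP.
apply: (eq_lincomb (- (u^* * e^* ^+ 3)) h).
rewrite uE /u; move: h'; rewrite uE /u => h'.
apply: (eq_lincomb 3 h'). ring: dD eE.
Qed.

Let HVV : (1 - w * e) * (V * V^*) = d^* * (1 - w * e^*) * (T * V).
Proof. by apply: (eq_lincomb V HA); ring. Qed.

(** At [e = w] one has [w * e^* = 1], so the right side of [HVV] vanishes; as [V != 0], this forces
    [w ^+ 2 = 1]. *)
Let e_neq_w : e != w.
Proof.
apply/eqP => h.
have : (1 - w * e) * (V * V^*) = 0.
  by rewrite HVV -h eE subrr mulr0 mul0r.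
move: W0; rewrite mulf_eq0 negb_or => /andP[_ V0] /eqP.
rewrite !mulf_eq0 conjC_eq0 (negbTE V0) !orbF h => /eqP w2.
(* The ideal generated by [w ^+ 2 + w + 1] and [1 - w ^+ 2] contains 3. *)
have : (3 : C) = 0.
  apply: (eq_lincomb (2 - w) w_root).
  by apply: (eq_lincomb (1 - w) w2); ring.
by apply/eqP; rewrite pnatr_eq0.
Qed.

(** Here the left side of [HVV] vanishes, because [w ^+ 3 = 1]. *)
Let e_neq_w2 : e != w ^+ 2.
Proof.
apply/eqP => h.
have ew : e^* = w.
  apply: (mulfI e0); rewrite eE h.
  apply: (eq_lincomb (1 - w) w_root). ring.
have : d^* * (1 - w * e^*) * (T * V) = 0.
  rewrite -HVV h; apply: (eq_lincomb ((1 - w) * (V * V^*)) w_root). ring.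
move/eqP; rewrite !mulf_eq0 conjC_eq0 (negbTE d0) -mulf_eq0 (negbTE W0) orbF ew.
move/eqP => w2.
have : (3 : C) = 0.
  apply: (eq_lincomb (2 - w) w_root).
  by apply: (eq_lincomb (1 - w) w2); ring.
by apply/eqP; rewrite pnatr_eq0.
Qed.

Let conjVV : e^* * (1 - w * e) * (V * V^*) = d * e * (1 - w * e^*) * (T * V)^*.
Proof.
have := congr1 Num.conj HVV.
rewrite !(rmorphD, rmorphN, rmorphM, rmorph1) /= !conjCK wc => h.
apply: (eq_lincomb (- w) h).
have h1 : w ^+ 3 = 1.
  by apply: (eq_lincomb (w - 1) w_root); ring.
ring: eE h1.
Qed.

(* [V * V^*] is real, so [HVV] agrees with its conjugate. *)
Let real_eq : e^* * d^* * (T * V) = d * e * (T * V)^*.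
Proof.
have we : 1 - w * e^* != 0.
  apply/eqP => h; case/eqP: e_neq_w.
  by apply: (eq_lincomb e h); ring: eE.
apply: (mulfI we); rewrite [RHS]mulrCA mulrA -[RHS]mulrA.
have := conjVV; rewrite -[LHS]mulrA HVV => h.
apply: (eq_lincomb 1 h); ring.
Qed.

Let real_poly : d * (3 * e ^+ 4 + e ^+ 3 - e) = e ^+ 3 - e - 3.
Proof.
have := real_eq; rewrite WE /u.
rewrite !(rmorphD, rmorphN, rmorphM, rmorphXn, rmorph_nat, rmorph1) /= conjCK.
move=> h.
apply: (mulfI u0).
apply: (eq_lincomb (d * e ^+ 2) h); rewrite /u; ring: dD eE.
Qed.

(** If [e != 1], then [e_or] gives [d * (2 * e + 1) = - (e + 2)]. Eliminating [d] from [real_poly]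
    leaves [3 * (e ^+ 3 - 1) * (e ^+ 2 + 3 * e + 1) = 0]. Cube roots of unity other than 1 are
    already excluded, and the quadratic factor would give [e + e^* = - 3]. *)
Let e1 : e = 1.
Proof.
apply/eqP/negPn/negP => en1.
have hd : d * (2 * e + 1) + e + 2 = 0.
  by move/eqP: e_or; rewrite mulf_eq0 subr_eq0 (negbTE en1) => /eqP.
have : (e - 1) * (e - w) * (e - w ^+ 2) * (e ^+ 2 + 3 * e + 1) = 0.
  have h1 : w ^+ 3 = 1.
    by apply: (eq_lincomb (w - 1) w_root); ring.
  apply: (mulfI (_ : (3 : C) != 0)); first by rewrite pnatr_eq0.
  apply: (eq_lincomb (3 * e ^+ 4 + e ^+ 3 - e) hd).
  apply: (eq_lincomb (- (2 * e + 1)) real_poly).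
  apply: (eq_lincomb (- 3 * (e - 1) * e * (e ^+ 2 + 3 * e + 1)) w_root).
  ring: h1.
move/eqP; rewrite !mulf_eq0 !subr_eq0 (negbTE en1) (negbTE e_neq_w).
rewrite (negbTE e_neq_w2) /=.
move=> /eqP h.
have /eqP[] : e + e^* != - 3%:R by exact: unit_conj_sum_neq.
by apply: (eq_lincomb e^* h); ring: eE.
Qed.

(** With [e = 1] everything is determined: [d = - 1], [s = - 2], [T = - V^*] and [V * V^* = 2], so
    the sum in [parseval] is 4 + 2 + 2 = 8 instead of 9. *)
Lemma no_flat_Z3_transform : False.
Proof.
have dm : d = - 1.
  apply: (mulfI (_ : (3 : C) != 0)); first by rewrite pnatr_eq0.
  have := real_poly; rewrite e1 => h.
  by apply: (eq_lincomb 1 h); ring.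
have um : u = - 2 by rewrite /u dm; ring.
have sm : s = - 2 by rewrite sue um e1 mulr1.
have h2 : (- 2 : C)^* = - 2 by rewrite rmorphN rmorph_nat.
have w1 : 1 - w != 0.
  by rewrite subr_eq0 eq_sym; apply/eqP => h; case/eqP: e_neq_w; rewrite e1 h.
have TV : T = - V^*.
  apply: (mulfI w1); have := HA; rewrite e1 dm rmorphN rmorph1 => h.
  by apply: (eq_lincomb 1 h); ring.
have VV : V * V^* = 2.
  have := WE; rewrite um e1 rmorph1 TV => h.
  by apply: (eq_lincomb (- 1) h); ring.
have : (1 : C) = 0.
  have := parseval; rewrite sm h2 TV rmorphN /= conjCK => h.
  apply: (eq_lincomb (- 1) h).
  by apply: (eq_lincomb 2 VV); ring.
by apply/eqP; rewrite oner_eq0.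
Qed.
End FlatZ3Transform.

(** * Reduction from Z/9 to Z/3 *)

(** The numbers [c], [c2], [c4] are the roots of X^3 - 3 X + 1, and the five moduli belong to the
    Fourier coefficients at 0, 1, 2, 3, 4. Those at 0 and 3 involve only [d] and [s]; those at 1, 2,
    4 differ by a cyclic shift of the roots, so a transform on Z/3 combines them. *)
Lemma flat_cycle9_spectrum (C : numClosedFieldType) (w c y1 y2 y4 : C) :
  let d := y1 * y2 * y4 in
  let c2 := c ^+ 2 - 2 in let c4 := 2 - c - c ^+ 2 in
  w ^+ 2 + w + 1 = 0 -> w^* = w ^+ 2 ->
  c ^+ 3 = 3 * c - 1 -> c^* = c ->
  y1 * y1^* = 1 -> y2 * y2^* = 1 -> y4 * y4^* = 1 ->
  `|d + 2 + 2 * (y1 + y2 + y4)| ^+ 2 = 9 ->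
  `|d - 1 + y1 * c + y2 * c2 + y4 * c4| ^+ 2 = 9 ->
  `|d - 1 + y1 * c2 + y2 * c4 + y4 * c| ^+ 2 = 9 ->
  `|d + 2 - (y1 + y2 + y4)| ^+ 2 = 9 ->
  `|d - 1 + y1 * c4 + y2 * c + y4 * c2| ^+ 2 = 9 ->
  d = 1 /\ y1 + y2 + y4 = 0.
Proof.
move=> d c2 c4 w_root wc c3 cc n1 n2 n4.
rewrite !normCK.
rewrite !(rmorphD, rmorphN, rmorphM, rmorph_nat, rmorphXn, rmorph1) /= cc.
rewrite /c2 /c4.
move=> P0 P1 P2 P3 P4.
have wE : w ^+ 2 = - w - 1.
  by apply: (eq_lincomb 1 w_root); ring.
pose s := y1 + y2 + y4.
pose T := y1 + w * y2 + w ^+ 2 * y4.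
pose V := y1 + w ^+ 2 * y2 + w * y4.
have sc : s^* = y1^* + y2^* + y4^* by rewrite !rmorphD.
have Tc : T^* = y1^* + w ^+ 2 * y2^* + w * y4^*.
  by rewrite !rmorphD !(rmorphXn, rmorphM) /= wc; ring: wE.
have Vc : V^* = y1^* + w * y2^* + w ^+ 2 * y4^*.
  by rewrite !rmorphD !(rmorphXn, rmorphM) /= wc; ring: wE.
have dc : d^* = y1^* * y2^* * y4^* by rewrite !rmorphM.
have n3 : (3 : C) != 0 by rewrite pnatr_eq0.
have n9 : (9 : C) != 0 by rewrite pnatr_eq0.
have dD : d * d^* = 1 by rewrite dc /d; ring: n1 n2 n4.
have TV_eq : T * V = s ^+ 2 - 3 * d * s^*.
  by rewrite sc /T /V /s /d; ring: n1 n2 n4 wE.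
have orth0 : s * V^* + T * s^* + V * T^* = 0.
  by rewrite Vc Tc sc /T /V /s; ring: n1 n2 n4 wE.
have parseval : s * s^* + T * T^* + V * V^* = 9.
  by rewrite Vc Tc sc /T /V /s; ring: n1 n2 n4 wE.
(* In [P0 + 2 * P3] the cross terms between [d + 2] and [s] cancel. *)
have ss : s * s^* = (d - 1) * (d - 1)^*.
  apply: (mulfI (_ : (6 : C) != 0)); first by rewrite pnatr_eq0.
  rewrite rmorphB rmorph1 /=.
  apply: (eq_lincomb 1 P0); apply: (eq_lincomb 2 P3).
  by rewrite -dc -sc -/s; ring: dD.
have [u0|u0] := eqVneq (d - 1) 0.
  split; first by apply/eqP; rewrite -subr_eq0 u0.
  by move/eqP: ss; rewrite u0 mul0r mulf_eq0 conjC_eq0 orbb => /eqP.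
exfalso.
apply: (@no_flat_Z3_transform C w d s (s / (d - 1)) T V) => //.
- by rewrite mulrC divfK.
- by rewrite fmorph_div /= mulf_div ss divff// mulf_neq0 ?conjC_eq0.
- apply: (mulfI n3).
  rewrite rmorphB rmorph1 /=.
  apply: (eq_lincomb 1 P0); apply: (eq_lincomb (- 1) P3).
  by rewrite -dc -sc -/s; ring.
- apply: (mulfI n9).
  rewrite rmorphB rmorph1 /=.
  (* This is the Lagrange resolvent of the three roots. It satisfies [r * r^* = 9], which is the
     factor 9 put on the goal. *)
  pose r := c + w * (c ^+ 2 - 2) + w ^+ 2 * (2 - c - c ^+ 2).
  apply: (eq_lincomb r P1); apply: (eq_lincomb (r * w ^+ 2) P2).
  apply: (eq_lincomb (r * w) P4).
  by rewrite -dc /r Vc Tc /V /T; ring: c3 wE n1 n2 n4.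
Qed.

(** * Matrix exponential and powers of the adjacency matrix *)

(* Stated without reference to the topology of [K], which [R[i]] only has as an
   instance of [numFieldType]. *)
Lemma expmx_entrywise (K : numFieldType) (n : nat) (M L : 'M[K]_n) :
  (forall i j (e : K), 0 < e -> \forall N \near \oo,
     `|L i j - \sum_(0 <= k < N) (k`!%:R)^-1 * (M ^+ k) i j| < e) ->
  expmx M = L.
Proof.
move=> H; rewrite /expmx.
apply: cvg_lim; first exact: norm_hausdorff.
apply/cvg_ballP => e e0.
have : \forall N \near \oo, forall i j,
    `|L i j - \sum_(0 <= k < N) (k`!%:R)^-1 * (M ^+ k) i j| < e.
  by apply: filter_forall => i; apply: filter_forall => j; exact: H.
apply: filterS => N HN; split=> // i j.
rewrite /ball /= /series /= summxE.
by under eq_bigr do rewrite mxE; exact: HN.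
Qed.

Section C9Powers.
Variables (K : fieldType) (z : K).
Hypothesis z9 : 9.-primitive_root z.

Lemma sum_adj_C9 (F : 'I_9 -> K) (a : 'Z_9) :
  \sum_j (C9 a j)%:R * F j = F (a - 1) + F (a + 1).
Proof.
rewrite (bigD1 (a - 1 : 'Z_9)) //= (bigD1 (a + 1 : 'Z_9)) /=; last first.
  by rewrite (inj_eq (addrI a)).
rewrite /cycle9_edge subKr eqxx mul1r opprD addNKr eqxx orbT mul1r.
rewrite big1 ?addr0// => j /andP[j1 j2].
have -> : (a - j == 1) = false.
  by apply/negP => /eqP h; case/eqP: j1; rewrite -h subKr.
have -> : (a - j == -1) = false.
  by apply/negP => /eqP h; case/eqP: j2; rewrite -[1]opprK -h subKr.
by rewrite mul0r.
Qed.

Lemma expr_Zp9D (x : K) (a b : 'Z_9) :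
  x ^+ 9 = 1 -> x ^+ (a + b)%R = x ^+ a * x ^+ b.
Proof. by move=> x9; rewrite -exprD -(expr_mod (a + b) x9). Qed.

(** Spectral decomposition by the characters of Z/9. The case [k = 0] is their orthogonality, a
    geometric sum of ratio [z ^+ a / z ^+ b]; the induction step is the eigenvector equation. *)
Lemma adjmx_C9_powE (c : K) (k : nat) (a b : 'I_9) :
  ((c *: adjmx K C9) ^+ k) a b =
  9%:R^-1 * \sum_(l < 9)
    (c * (z ^+ l + z ^- l)) ^+ k * (z ^+ l ^+ a / z ^+ l ^+ b).
Proof.
have K9 := prim_root_natf_neq0 z9.
have z0 : z != 0 by rewrite (prim_root_eq0 z9).
have zl9 l : z ^+ l ^+ 9 = 1 by rewrite exprAC (prim_expr_order z9) expr1n.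
elim: k a => [|k IH] a.
  rewrite expr0 mxE.
  have -> : \sum_(l < 9) (c * (z ^+ l + z ^- l)) ^+ 0
      * (z ^+ l ^+ a / z ^+ l ^+ b) = \sum_(l < 9) (z ^+ a / z ^+ b) ^+ l.
    by apply: eq_bigr => l _; rewrite expr0 mul1r expr_div_n -!(exprAC _ l).
  have [<-|ab] := eqVneq a b.
    rewrite divff ?expf_neq0//.
    by under eq_bigr do rewrite expr1n; rewrite sumr_const card_ord mulVf.
  have q1 : z ^+ a / z ^+ b - 1 != 0.
    rewrite subr_eq0; apply: contra ab => /eqP h.
    have : z ^+ a == z ^+ b by rewrite -[z ^+ b]mul1r -h divfK ?expf_neq0.
    by rewrite (eq_prim_root_expr z9) !modn_small.
  apply: (mulfI q1); rewrite mulrCA -subrX1 expr_div_n !zl9 divr1 subrr !mulr0.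
  by [].
rewrite exprS mxE.
under eq_bigr do rewrite !mxE -mulrA IH.
rewrite -big_distrr /= sum_adj_C9 -mulrDr mulrCA; congr (_ * _).
rewrite -big_split /= big_distrr /=; apply: eq_bigr => l _.
have x0 : z ^+ l != 0 by rewrite expf_neq0.
rewrite (@expr_Zp9D _ a 1 (zl9 l)) expr1.
have -> : (z ^+ l) ^+ ((a : 'Z_9) - 1)%R = (z ^+ l) ^+ a / z ^+ l.
  apply: (mulIf x0); rewrite divfK//.
  by rewrite -[X in _ * X]expr1 -(@expr_Zp9D _ _ 1 (zl9 l)) subrK.
rewrite exprS; field.
by rewrite x0 expf_neq0.
Qed.

End C9Powers.

(** * The numbers e^(iy) and the entries of U(t) *)

Definition expi (R : realType) (y : R) : R[i] := (cos y +i* sin y)%C.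

Section Expi.
Variable R : realType.
Implicit Types x y t : R.

Lemma expiD x y : expi (x + y) = expi x * expi y.
Proof.
rewrite /expi cosD sinD; apply/eqP; rewrite eq_complex /= eqxx /=.
by rewrite addrC.
Qed.

Lemma expi0 : expi (0 : R) = 1.
Proof. by rewrite /expi cos0 sin0. Qed.

Lemma expiN x : expi (- x) = (expi x)^*.
Proof. by rewrite /expi cosN sinN. Qed.

Lemma expi_mul_conj x : expi x * (expi x)^* = 1.
Proof. by rewrite -expiN -expiD subrr expi0. Qed.

Lemma expiV x : expi (- x) = (expi x)^-1.
Proof.
apply: divr1_eq; rewrite invrK expiN mulrC; exact: expi_mul_conj.
Qed.

Lemma expiMn x n : expi (x *+ n) = expi x ^+ n.
Proof.
elim: n => [|n IH]; first by rewrite mulr0n expi0 expr0.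
by rewrite mulrS expiD IH exprS.
Qed.

Lemma expi_cos x : expi x + expi (- x) = (2 * cos x)%:C%C.
Proof.
rewrite /expi cosN sinN; apply/eqP; rewrite eq_complex /= subrr eqxx andbT.
by apply/eqP; ring.
Qed.

Lemma expi_coeff y k :
  (k`!%:R)^-1 * ('i%C * y%:C%C) ^+ k =
  (cos_coeff y k)%:C%C + 'i%C * (sin_coeff y k)%:C%C :> R[i].
Proof.
have i2 : 'i%C ^+ 2 = -1 :> R[i] by rewrite sqr_i.
rewrite -(rmorph_nat (real_complex R)) -fmorphV exprMn -rmorphXn /=.
rewrite /cos_coeff /sin_coeff /= -{2}(odd_double_half k) exprD -mul2n exprM i2.
have -> : (-1) ^+ k./2 = ((-1) ^+ k./2)%:C%C :> R[i].
  by rewrite rmorphXn rmorphN rmorph1.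
case: (boolP (odd k)) => ok /=.
  have -> : k.-1./2 = k./2.
    by rewrite -{1}(odd_double_half k) ok add1n /= doubleK.
  rewrite !mul0r rmorph0 add0r expr1 !rmorphM rmorph1 /=; ring.
rewrite !mul0r rmorph0 mulr0 addr0 expr0 !rmorphM rmorph1 /=; ring.
Qed.

Lemma expi_series y (e : R[i]) : 0 < e ->
  \forall N \near \oo,
    `|expi y - \sum_(0 <= k < N) (k`!%:R)^-1 * ('i%C * y%:C%C) ^+ k| < e.
Proof.
move=> e0.
(* In the order of [R[i]], positive elements are real; cosine and sine each receive half of [r]. *)
have [r re] : exists r, e = (r%:C)%C.
  by apply/complex_realP/gtr0_real.
have r0 : 0 < r / 2 by rewrite divr_gt0// -ltcR -re.
have cc : series (cos_coeff y) @ \oo --> cos y.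
  rewrite cos.unlock; exact: is_cvg_series_cos_coeff.
have sc : series (sin_coeff y) @ \oo --> sin y.
  rewrite sin.unlock; exact: is_cvg_series_sin_coeff.
move/cvgrPdist_lt/(_ _ r0) in cc.
move/cvgrPdist_lt/(_ _ r0) in sc.
near=> N.
have cN : `|cos y - series (cos_coeff y) N| < r / 2 by near: N.
have sN : `|sin y - series (sin_coeff y) N| < r / 2 by near: N.
under eq_bigr do rewrite expi_coeff.
rewrite big_split /= -big_distrr /= -!rmorph_sum /=.
set a := \sum_(_ <= _ < _) cos_coeff _ _; set b := \sum_(_ <= _ < _) _.
have -> : expi y - (a%:C%C + 'i%C * b%:C%C) =
    (cos y - a)%:C%C + 'i%C * (sin y - b)%:C%C.
  by apply/eqP; rewrite eq_complex /=; apply/andP; split; apply/eqP; ring.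
apply: (le_lt_trans (ler_normD _ _)); rewrite normrM.
have nR (x : R) : `|(x%:C)%C| = (`|x|%:C)%C :> R[i].
  by rewrite normc_def /= expr0n addr0 sqrtr_sqr.
have -> : `|'i%C| = 1 :> R[i].
  by rewrite normc_def /= expr0n add0r expr1n sqrtr1.
rewrite mul1r !nR -rmorphD re ltcR (splitr r).
exact: ltrD.
Unshelve. all: by end_near. Qed.

Lemma expi_eq1 y : expi y = 1 -> exists m : int, y = m%:~R * (pi *+ 2).
Proof.
move=> y1; have p0 : 0 < pi *+ 2 :> R by rewrite pmulrn_lgt0// pi_gt0.
have e2 (m : int) : expi (m%:~R * (pi *+ 2)) = 1 :> R[i].
  have e2n (n : nat) : expi (n%:R * (pi *+ 2)) = 1 :> R[i].
    by rewrite mulr_natl expiMn /expi cos2pi sin2pi expr1n.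
  by case: m => n; rewrite ?NegzE ?mulrNz ?mulNr ?expiV e2n ?invr1.
pose m := Num.floor (y / (pi *+ 2)); exists m.
pose x := y - m%:~R * (pi *+ 2).
have x1 : expi x = 1 by rewrite /x expiD expiV e2 invr1 mulr1.
have x0 : 0 <= x by rewrite subr_ge0 -ler_pdivlMr// floor_le_tmp.
have x2 : x < pi *+ 2.
  rewrite ltrBlDr -{1}[pi *+ 2]mul1r -mulrDl -ltr_pdivrMr// addrC.
  by have := floorD1_gt (y / (pi *+ 2)); rewrite intrD.
apply/eqP; rewrite -subr_eq0 -/x; apply/eqP/le_anti; rewrite x0 andbT leNgt.
apply/negP => xgt0.
(* For x strictly between 0 and 2 pi, cos x = 1 - 2 sin^2(x/2) is less than 1. *)
have s0 : 0 < sin (x / 2) by apply: sin_gt0_pi; move: x2; rewrite mulr2n; lra.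
have : cos x = 1 by case: x1.
rewrite (splitr x) cosD -!expr2 cos2sin2 => h.
have : 0 < sin (x / 2) ^+ 2 by rewrite exprn_gt0.
by lra.
Qed.

(** The error of a partial sum is an average of nine scalar errors weighted by numbers of modulus 1,
    so a common bound on these carries over. *)
Lemma transition_C9E (z : R[i]) (th : 'I_9 -> R) t a b :
  9.-primitive_root z -> `|z| = 1 ->
  (forall l : 'I_9, z ^+ l + z ^- l = (th l)%:C%C) ->
  transition_mx C9 t a b =
  9%:R^-1 * \sum_(l < 9) expi (t * th l) * (z ^+ l ^+ a / z ^+ l ^+ b).
Proof.
move=> z9 z1 zth; pose L : 'M[R[i]]_9 := \matrix_(a, b)
  (9%:R^-1 * \sum_(l < 9) expi (t * th l) * (z ^+ l ^+ a / z ^+ l ^+ b)).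
suff -> : transition_mx C9 t = L by rewrite mxE.
apply: expmx_entrywise => i j e e0; rewrite mxE.
have : \forall N \near \oo, forall l : 'I_9, `|expi (t * th l) -
    \sum_(0 <= k < N) (k`!%:R)^-1 * ('i%C * (t * th l)%:C%C) ^+ k| < e.
  by apply: filter_forall => l; exact: expi_series.
apply: filterS => N HN.
under [X in _ - X]eq_bigr do
  rewrite (adjmx_C9_powE z9) mulrCA.
rewrite -big_distrr /= -mulrBr.
under [X in _ - X]eq_bigr do rewrite big_distrr /=.
rewrite [X in _ - X]exchange_big /= -sumrB normrM normfV normr_nat.
rewrite ltr_pdivrMl ?ltr0n//; apply: le_lt_trans (ler_norm_sum _ _ _) _.
have -> : 9%:R * e = \sum_(l < 9) e by rewrite sumr_const card_ord mulr_natl.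
apply: ltr_sum => [|l _].
  by apply/hasP; exists ord0; rewrite ?mem_index_enum.
rewrite (_ : _ - _ = (expi (t * th l) -
    \sum_(0 <= k < N) (k`!%:R)^-1 * ('i%C * (t * th l)%:C%C) ^+ k)
      * (z ^+ l ^+ i / z ^+ l ^+ j)); last first.
  rewrite mulrBl big_distrl /=; congr (_ - _); apply: eq_bigr => k _.
  by rewrite zth -!mulrA rmorphM.
by rewrite normrM !normf_div !normrX z1 !expr1n divr1 mulr1.
Qed.

End Expi.

(** * The cubic X^3 - 3 X + 1 and ninth roots of unity *)

(* Infinite descent: [X^3 - 3 X + 1] has no root modulo 2. *)
Lemma cubic_no_int_root (n m : int) :
  n ^+ 3 = 3 * n * m ^+ 2 - m ^+ 3 -> m = 0.
Proof.
have [k] := ubnP `|m|%N; elim: k n m => // k IH n m mk h.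
have par (x : int) : exists y, x = 2 * y \/ x = 2 * y + 1.
  by exists (x %/ 2)%Z; lia.
have [a [na|na]] := par n; have [b [mb|mb]] := par m.
- have [->//|m0] := eqVneq m 0.
  have b0 : b = 0.
    apply: (IH a b); first by lia.
    apply: (mulfI (_ : (8 : int) != 0)) => //.
    by move: h; rewrite na mb => h; apply: (eq_lincomb 1 h); ring.
  by rewrite mb b0 mulr0.
(* Unless [n] and [m] are both even, n^3 - 3 n m^2 + m^3 is odd; each remaining case displays it as
   [2 * _ + 1]. *)
- exfalso.
  have : 2 * (4 * a ^+ 3 - 3 * a * m ^+ 2 + 4 * b ^+ 3 + 6 * b ^+ 2 + 3 * b)
      + 1 = 0 :> int.
    apply: (eq_lincomb 1 h); rewrite na mb; ring.
  by lia.
- exfalso.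
  have : 2 * (4 * a ^+ 3 + 6 * a ^+ 2 + 3 * a - 3 * n * 2 * b ^+ 2
      + 4 * b ^+ 3) + 1 = 0 :> int.
    apply: (eq_lincomb 1 h); rewrite na mb; ring.
  by lia.
- exfalso.
  have : 2 * (4 * a ^+ 3 + 6 * a ^+ 2 + 3 * a - 3 * a * m ^+ 2 - 6 * b ^+ 2
      - 6 * b - 1 + 4 * b ^+ 3 + 6 * b ^+ 2 + 3 * b) + 1 = 0 :> int.
    apply: (eq_lincomb 1 h); rewrite na mb; ring.
  by lia.
Qed.

Lemma expi_prim_root9 (R : realType) :
  9.-primitive_root (expi (pi *+ 2 / 9%:R : R)).
Proof.
set z := expi _.
have z9 : z ^+ 9 = 1.
  rewrite -expiMn -[_ / _ *+ _]mulr_natr divfK ?pnatr_eq0//.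
  by rewrite /expi cos2pi sin2pi.
have [m zm m9] := prim_order_exists (isT : (0 < 9)%N) z9.
have z3 : z ^+ 3 != 1.
  rewrite -expiMn; apply/eqP => -[_ h].
  have := pi_gt0 R => p0.
  have : 0 < sin (pi *+ 2 / 9%:R *+ 3 : R).
    by apply: sin_gt0_pi; rewrite mulr2n -[_ *+ 3]mulr_natr; lra.
  by rewrite h ltxx.
have : m \in divisors 9 by rewrite -dvdn_divisors.
rewrite (_ : divisors 9 = [:: 1; 3; 9]%N)// !inE.
case/or3P => /eqP mE; last by rewrite -mE.
- case/eqP: z3; have := prim_expr_order zm.
  by rewrite mE expr1 => ->; rewrite expr1n.
- by case/eqP: z3; have := prim_expr_order zm; rewrite mE.
Qed.

(** For c = 2 cos(2 pi / 9) these are the numbers 2 cos(2 pi k / 9), written as polynomials in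
    [c]. *)
Definition cycle9_eig (R : pzRingType) (c : R) (k : nat) : R :=
  nth 0 [:: 2; c; c ^+ 2 - 2; -1; 2 - c - c ^+ 2;
            2 - c - c ^+ 2; -1; c ^+ 2 - 2; c] (k %% 9).

Lemma cycle9_eigP (R : realType) (z : R[i]) :
  9.-primitive_root z -> z * z^* = 1 ->
  exists2 c : R, c ^+ 3 = 3 * c - 1 &
    forall k, z ^+ k + z^* ^+ k = (cycle9_eig c k)%:C%C.
Proof.
move=> z9 zv; have z9E : z ^+ 9 = 1 := prim_expr_order z9.
have [c cE] : exists c : R, z + z^* = c%:C%C.
  by case: z {z9 zv z9E} => a b; exists (a + a);
    rewrite -[_^*]/(a -i* b)%C; apply/eqP; rewrite eq_complex /= subrr !eqxx.
have z3 : z ^+ 3 - 1 != 0 by rewrite subr_eq0 -(prim_order_dvd z9).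
(* The ninth cyclotomic polynomial is (X^9 - 1) / (X^3 - 1) = X^6 + X^3 + 1. *)
have phi : z ^+ 6 = - z ^+ 3 - 1.
  by apply: (mulfI z3); apply: (eq_lincomb 1 z9E); ring.
have v9 : z^* ^+ 9 = 1 by rewrite -rmorphXn z9E rmorph1.
move: z^* zv v9 cE => v zv v9 cE.
(* The conjugate is the inverse [z ^+ 8], reduced by [phi]. *)
have vz : v = - z ^+ 5 - z ^+ 2.
  have : v * z ^+ 9 = v by rewrite z9E mulr1.
  by move=> <-; ring: zv phi.
exists c.
  apply: complexI; rewrite rmorphXn rmorphB rmorphM rmorph_nat rmorph1 /= -cE.
  by rewrite vz; ring: phi.
move=> k; rewrite -(expr_mod k z9E) -(expr_mod k v9) /cycle9_eig.
have : (k %% 9 < 9)%N by rewrite ltn_pmod.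
case: (k %% 9)%N => [|[|[|[|[|[|[|[|[|l]]]]]]]]] //= _;
  rewrite ?(rmorphB, rmorphN) ?rmorphXn ?rmorph1 ?rmorph_nat /= -?cE vz;
  by ring: phi.
Qed.

(** * From uniform mixing to the contradiction *)

(** Column 0 of U(t) is multiplied by the unimodular number [expi t], which normalizes the term of
    eigenvalue -1 to 1; the indices [l] and [9 - l] are then paired. *)
Lemma C9_mixing_flat (R : realType) (t c : R) (z : R[i]) :
  9.-primitive_root z -> z * z^* = 1 ->
  (forall k, z ^+ k + z^* ^+ k = (cycle9_eig c k)%:C%C) ->
  uniform_mixing C9 t -> forall a : 'I_9,
  `|expi (t *+ 3) + expi (t * c + t) * (cycle9_eig c a)%:C%C
    + expi (t * (c ^+ 2 - 2) + t) * (cycle9_eig c (2 * a))%:C%C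
    + (cycle9_eig c (3 * a))%:C%C
    + expi (t * (2 - c - c ^+ 2) + t) * (cycle9_eig c (4 * a))%:C%C| ^+ 2
  = 9 :> R[i].
Proof.
move=> z9 zv zth mix a.
have z9E : z ^+ 9 = 1 := prim_expr_order z9.
have z1 := norm_unit_conj zv.
have ne := norm_unit_conj (expi_mul_conj t).
have vE : z^-1 = z^*.
  have z0 : z != 0 by rewrite (prim_root_eq0 z9).
  by apply: (mulfI z0); rewrite mulfV.
have zthV (l : 'I_9) : z ^+ l + z ^- l = (cycle9_eig c l)%:C%C.
  by rewrite -exprVn vE.
have main : `|\sum_(l < 9) expi (t * cycle9_eig c l + t) * z ^+ l ^+ a| ^+ 2
    = 9 :> R[i].
  have := mix a ord0; rewrite (transition_C9E t _ _ z9 z1 zthV).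
  under eq_bigr do rewrite expr0 divr1.
  under [in X in _ -> X]eq_bigr do rewrite expiD mulrAC.
  rewrite -big_distrl /= !normrM normfV normr_nat ne mulr1.
  have n9 : (9 : R[i]) != 0 by rewrite pnatr_eq0.
  set q := `|_|; rewrite exprMn exprVn => h.
  by rewrite -[LHS](mulKf (expf_neq0 2 n9)) mulrCA h; field.
rewrite -[RHS]main; congr (`|_| ^+ 2).
rewrite -!zth !big_ord_recl big_ord0 /cycle9_eig /= /bump /= !add1n.
rewrite expr0 !expr1n expr1.
have -> : expi (t * 2 + t) = expi (t *+ 3).
  by congr expi; rewrite -mulr_natr; ring.
have -> : expi (t * -1 + t) = 1 by rewrite mulrN1 addNr expi0.
have zE k : (k <= 9)%N -> z^* ^+ k = z ^+ (9 - k).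
  move=> k9; apply: (mulfI (_ : z ^+ k != 0)).
    by rewrite expf_neq0// (prim_root_eq0 z9).
  by rewrite -exprMn zv expr1n -exprD subnKC.
rewrite !exprM (zE 2)// (zE 3)// (zE 4)// -[z^*]expr1 (zE 1)//=.
by ring.
Qed.

Lemma C9_not_uniform_mixing (R : realType) (t : R) : ~ uniform_mixing C9 t.
Proof.
move=> mix.
have z9 := expi_prim_root9 R; have zv := expi_mul_conj (pi *+ 2 / 9%:R : R).
have [c c3 zth] := cycle9_eigP z9 zv.
have w9 := prim_expr_order z9.
have flat := C9_mixing_flat z9 zv zth mix.
move: (expi _) z9 zv zth w9 flat => z z9 zv zth w9 flat.
pose y1 := expi (t * c + t); pose y2 := expi (t * (c ^+ 2 - 2) + t).
pose y4 := expi (t * (2 - c - c ^+ 2) + t).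
have dE : y1 * y2 * y4 = expi (t *+ 3).
  by rewrite /y1 /y2 /y4 -!expiD; congr expi; rewrite -mulr_natr; ring.
have w_root : z ^+ 3 ^+ 2 + z ^+ 3 + 1 = 0.
  have z3 : z ^+ 3 - 1 != 0 by rewrite subr_eq0 -(prim_order_dvd z9).
  by apply: (mulfI z3); apply: (eq_lincomb 1 w9); ring.
have [d1 s0] : y1 * y2 * y4 = 1 /\ y1 + y2 + y4 = 0.
  have c2E : (c ^+ 2 - 2)%:C%C = c%:C%C ^+ 2 - 2 :> R[i].
    by rewrite rmorphB rmorphXn rmorph_nat.
  have c4E : (2 - c - c ^+ 2)%:C%C = 2 - c%:C%C - c%:C%C ^+ 2 :> R[i].
    by rewrite !rmorphB rmorphXn rmorph_nat.
  have flatE a q : q = expi (t *+ 3) + y1 * (cycle9_eig c a)%:C%C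
    + y2 * (cycle9_eig c (2 * a))%:C%C + (cycle9_eig c (3 * a))%:C%C
    + y4 * (cycle9_eig c (4 * a))%:C%C -> (a < 9)%N -> `|q| ^+ 2 = 9.
    by move=> -> a9; exact: (flat (Ordinal a9)).
  apply: (@flat_cycle9_spectrum _ (z ^+ 3) c%:C%C) => //;
    try exact: expi_mul_conj.
  - rewrite rmorphXn /=; apply: (mulfI (_ : z ^+ 3 != 0)).
      by rewrite expf_neq0// (prim_root_eq0 z9).
    by rewrite -exprMn zv expr1n -exprS -exprM w9.
  - by rewrite -rmorphXn c3 rmorphB rmorphM rmorph_nat rmorph1.
  - exact: conjc_real.
  - by apply: (flatE 0%N); rewrite // -dE /cycle9_eig /= rmorph_nat; ring.
  - apply: (flatE 1%N); rewrite // -dE /cycle9_eig /= c2E c4E rmorphN1.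
    by ring.
  - apply: (flatE 2%N); rewrite // -dE /cycle9_eig /= c2E c4E rmorphN1.
    by ring.
  - apply: (flatE 3%N); rewrite // -dE /cycle9_eig /= rmorphN1 rmorph_nat.
    by ring.
  - apply: (flatE 4%N); rewrite // -dE /cycle9_eig /= c2E c4E rmorphN1.
    by ring.
have e3 : expi (t *+ 3) = 1 by rewrite -dE.
have y13 : y1 ^+ 3 = 1.
  have sc0 : y1^* + y2^* + y4^* = 0 by rewrite -!rmorphD s0 rmorph0.
  have u1 : y1 * y1^* = 1 := expi_mul_conj _.
  have u2 : y2 * y2^* = 1 := expi_mul_conj _.
  have u4 : y4 * y4^* = 1 := expi_mul_conj _.
  (* By [sc0] the second elementary symmetric function of [y1], [y2], [y4], which is [d * s^*],
     vanishes as well; hence all three are roots of X^3 - 1. *)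
  apply: (eq_lincomb (y1 ^+ 2) s0).
  apply: (eq_lincomb 1 d1).
  apply: (eq_lincomb (- y1 * (y1 * y2 * y4)) sc0).
  by ring: u1 u2 u4.
have e3c : expi (t * c *+ 3) = 1.
  by move: y13; rewrite -expiMn mulrnDl expiD e3 mulr1.
have [m mE] := expi_eq1 e3; have [n nE] := expi_eq1 e3c.
have p0 : (pi *+ 2 : R) != 0 by rewrite mulrn_eq0 /= gt_eqF// pi_gt0.
have mc : m%:~R * c = n%:~R.
  by apply: (mulIf p0); rewrite -nE mulrAC -mE mulrnAl.
have m0 : m = 0.
  apply: (@cubic_no_int_root n); apply: (@intr_inj R).
  (* As [m * c = n], the required equation is the cubic of [c] multiplied by [m ^+ 3]. *)
  rewrite intrB !intrM -mc.
  by apply: (eq_lincomb (m%:~R ^+ 3) c3); ring.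
have t0 : t = 0.
  by apply/eqP; move/eqP: mE; rewrite m0 mul0r mulrn_eq0.
move/eqP: s0; rewrite /y1 /y2 /y4 t0 !mul0r addr0 expi0.
by rewrite (_ : 1 + 1 + 1 = 3%:R) ?pnatr_eq0//; ring.
Qed.

Theorem theorem2p1 (R : realType) : ~ exists t : R, uniform_mixing C9 t.
Proof. by case=> t; exact: C9_not_uniform_mixing. Qed.
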